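(* Let $G$ be a locally finite $D(0)$-group. Then $G$ is a finite group.
   Context: Groups may be finite or infinite. A $D(0)$-group is a group $G$ having no deficient non-trivial conjugacy class, where a non-trivial element $x\in G$ (and its conjugacy class) is called deficient if $\langle x\rangle$ is properly contained in $C_G(x)$. Thus $G$ is a $D(0)$-group if and only if $C_G(x)=\langle x\rangle$ for every $x\in G\setminus\{1\}$. A group is locally finite if each of its finitely generated subgroups is finite. *)

(* Defs.v *)
From mathcomp Require Import all_boot.
From mathcomp Require Import boolp classical_sets functions cardinality.

Set Implicit Arguments.
Unset Strict Implicit.
Unset Printing Implicit Defensive.

Local Open Scope classical_set_scope.
Local Open Scope group_scope.

(* Groups are [groupType]s, hence possibly infinite; the choice structure that
   a [groupType] carries is no restriction, since classically (boolp) every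
   type has one. Subsets are classical sets, so [x \in H] below is a classical,
   not a decidable, membership. *)

Definition subgroup (G : groupType) (H : set G) : Prop :=
  group_closed [in H].

Definition subgroup_generated (G : groupType) (A : set G) : set G :=
  smallest (@subgroup G) A.

Definition cyclic_subgroup (G : groupType) (x : G) : set G :=
  subgroup_generated [set x].

Definition centralizer (G : groupType) (x : G) : set G :=
  [set y | commute x y].

Definition conj_class (G : groupType) (x : G) : set G :=
  [set x ^ g | g in [set: G]].

(* The order [`<`] on sets is proper inclusion. *)
Definition deficient (G : groupType) (x : G) : Prop :=
  x <> 1 /\ cyclic_subgroup x `<` centralizer x.

Definition deficient_class (G : groupType) (K : set G) : Prop :=
  exists2 x : G, deficient x & K = conj_class x.

Definition D0_group (G : groupType) : Prop :=
  forall K : set G, ~ deficient_class K.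

Definition finitely_generated (G : groupType) (H : set G) : Prop :=
  exists2 A : set G, finite_set A & H = subgroup_generated A.

Definition locally_finite (G : groupType) : Prop :=
  forall H : set G, finitely_generated H -> finite_set H.

(* Main.v *)
Require Import Defs.
From HB Require Import structures.
From mathcomp Require Import all_boot all_fingroup all_solvable.
From mathcomp Require Import zify.

(** In a D(0)-group the centralizer of every non-trivial element is the cyclic
    subgroup it generates, and this passes to subgroups. Local finiteness then
    reduces the theorem to a bound on finite groups: a finite group in which
    [C(x) = <x>] for all [x <> 1] has no chain of subgroups [1 < A < B < G]
    ([no_chain_selfcent]). An infinite locally finite group would contain one,
    obtained by adjoining three elements in turn, each outside the finite
    subgroup generated by the previous ones.

    For the finite group, two observations are immediate: every non-trivial
    element has prime order ([prime_order_selfcent]), and the order of [G] is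
    square-free since a Sylow subgroup has a non-trivial center
    ([logn_selfcent]). It is thus enough to show that at most two primes divide
    [#|G|] ([size_primes_selfcent]). A subgroup [X] of order [p] is
    self-centralizing, and distinct conjugates of [X] meet trivially; hence the
    conjugates of [X] contain [(p - 1) * #|G| / (p * e)] non-trivial elements,
    where [e] is the index of [X] in its normalizer. As the automorphism group
    of [X] is cyclic, [e] is 1 or a prime divisor of [#|G|] below [p]
    ([index_norm_selfcent]). For the smallest prime [e = 1], and for the second
    there are only two possibilities; a third prime would then make these sets of
    elements too large to fit in [G] ([class_sizes_overflow]). *)

Set Implicit Arguments.
Unset Strict Implicit.
Unset Printing Implicit Defensive.

(** * Counting *)

(** The numbers come from the primes [p < q < r] and the conjugates of a subgroup
    of each of these orders: if its normalizer has index [k], the conjugates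
    contain [k * p.-1] non-trivial elements, and [p * e] is the order of the
    normalizer. The first family has [n - k1 >= n / 2] elements. If [e2 = 1] the
    second has [n - k2 >= n / 2], and the two already reach [n]. If [e2 = p] the
    first two have [n - k2] elements, and [e3 <= q] forces [k3 * r.-1 >= k2]. *)
Lemma class_sizes_overflow n p q r k1 k2 k3 e2 e3 :
    1 < p < q -> q < r -> n = k1 * p -> n = k2 * (q * e2) -> n = k3 * (r * e3) ->
    e2 = 1 \/ e2 = p -> e3 <= q -> 0 < n ->
  n <= k1 * p.-1 + k2 * q.-1 + k3 * r.-1.
Proof.
case: p => [|p] // /andP[p_gt0]; case: q => [|q] // ltpq.
case: r => [|r] //= ltqr n1 n2 n3 e2P le_e3 n_gt0.
rewrite !mulnS in n1 n2 n3 *.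
case: e2P => e2E; subst e2.
  have: k1 <= k1 * p by rewrite leq_pmulr.
  have: k2 <= k2 * q by rewrite leq_pmulr //; lia.
  by move: n1 n2; rewrite muln1; lia.
(* The first two families now have exactly [n - k2] elements. *)
have k1E : k1 = k2 * q.+1.
  by apply/eqP; rewrite -(eqn_pmul2r (ltn0Sn p)); nia.
suff : k2 <= k3 * r by nia.
(* Let P, Q and R be the three primes, whose predecessors are now p, q and r:
   k2 * 2 * Q <= k2 * Q * P = n <= k3 * R * Q, and R <= 2 * (R - 1). *)
have : k2 * (2 * q.+1) <= k3 * (2 * r * q.+1).
  apply: (@leq_trans n); first by rewrite n2 leq_mul2l mulnC leq_mul2l; lia.
  by rewrite n3 !leq_mul //; lia.
by nia.
Qed.

(** * Finite groups with self-centralizing cyclic subgroups *)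

Section SelfCentralizing.

Local Open Scope group_scope.

Variables (gT : finGroupType) (G : {group gT}).
Hypothesis cent1_cycle : {in G^#, forall x, 'C_G[x] = <[x]>}.

Lemma cycle_eq_selfcent x y : x \in G^# -> y \in G^# -> y \in <[x]> ->
  <[y]> = <[x]>.
Proof.
move=> Gx Gy yx; apply/eqP; rewrite eqEsubset cycle_subG yx cycle_subG /=.
rewrite -(cent1_cycle Gy) in_setI; case/setD1P: Gx => _ -> /=.
by rewrite cent1C (subsetP _ y yx) // cycle_subG cent1id.
Qed.

(** A power [y <> 1] of [x] is centralized by [x], so [<[y]>] contains [x]: no
    proper non-trivial subgroup of [<[x]>] exists. *)
Lemma prime_order_selfcent x : x \in G^# -> prime #[x].
Proof.
move=> Gx; have [ntx Gxx] := setD1P Gx.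
have ox_gt1 : 1 < #[x] by rewrite order_gt1.
have [y yx oy] := Cauchy (pdiv_prime ox_gt1) (pdiv_dvd #[x]).
have Gy : y \in G^#.
  rewrite in_setD1 -order_gt1 oy prime_gt1 ?pdiv_prime //=.
  by apply: subsetP yx; rewrite cycle_subG.
by rewrite /order -(cycle_eq_selfcent Gx Gy yx) -/(order _) oy pdiv_prime.
Qed.

(** A Sylow subgroup centralizes a non-trivial element of its own center, hence
    it is generated by that element and has prime order. *)
Lemma logn_selfcent p : p \in \pi(G) -> logn p #|G| = 1%N.
Proof.
move=> piGp; have p_pr : prime p by move: piGp; rewrite mem_primes; case/andP.
have logp_gt0 : (0 < logn p #|G|)%N by rewrite logn_gt0.
have [P sylP] := Sylow_exists p G.
have [sPG pP _] := and3P sylP.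
have oP := card_Hall sylP.
have ntP : P :!=: 1.
  by rewrite -cardG_gt1 oP p_part -(expn0 p) ltn_exp2l ?prime_gt1.
have [z Zz ntz] : exists2 z, z \in 'Z(P) & z != 1.
  by apply/trivgPn; rewrite (center_nil_eq1 (pgroup_nil pP)).
have [Pz cPz] := setIP Zz.
have Gz : z \in G^# by rewrite in_setD1 ntz (subsetP sPG).
have defP : P :=: <[z]>.
  apply/eqP; rewrite eqEsubset cycle_subG Pz andbT -(cent1_cycle Gz).
  by rewrite subsetI sPG sub_cent1.
have := prime_order_selfcent Gz; rewrite /order -defP oP p_part => pk_pr.
apply/eqP; rewrite eqn_leq logp_gt0 andbT -{1}(pfactorK (logn p #|G|) p_pr).
by rewrite logn_prime // leq_b1.
Qed.

(** A non-trivial element common to [<[x]>] and a conjugate generates both. *)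
Lemma normedTI_cycle_selfcent x : x \in G^# ->
  normedTI <[x]>^# G 'N_G(<[x]>).
Proof.
move=> Gx; have [ntx Gxx] := setD1P Gx.
have sXG : <[x]> \subset G by rewrite cycle_subG.
apply/normedTI_P; split.
- by rewrite setD_eq0 subG1 cycle_eq1.
- by rewrite normD1.
move=> g Gg /pred0Pn[y /= /andP[X1y]].
rewrite conjD1g -cycleJ => /setD1P [_ Xyg].
have [nty Xy] := setD1P X1y.
have Gy : y \in G^# by rewrite in_setD1 nty (subsetP sXG).
have Gxg : x ^ g \in G^# by rewrite in_setD1 conjg_eq1 ntx groupJ.
rewrite inE Gg /= inE -cycleJ.
by rewrite -(cycle_eq_selfcent Gxg Gy Xyg) (cycle_eq_selfcent Gx Gy Xy).
Qed.

(** By self-centralization ['N_G(<[x]>) / <[x]>] embeds in the automorphism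
    group of a group of prime order, which is cyclic of order [#[x] - 1]. Its
    order [e] divides the order of any representative [k] of a generator, and
    that order is 1 or a prime. *)
Lemma index_norm_selfcent x : x \in G^# ->
  let e := #|'N_G(<[x]>) : <[x]>| in
  e = 1%N \/ [/\ prime e, e \in \pi(G) & e < #[x]].
Proof.
move=> Gx e; have [ntx Gxx] := setD1P Gx.
have p_pr := prime_order_selfcent Gx.
set X := <[x]> in e *; set N := 'N_G(X).
have sXG : X \subset G by rewrite cycle_subG.
have nXN : N \subset 'N(X) by rewrite subsetIr.
have sXN : X \subset N by rewrite subsetI sXG normG.
have cX : 'C_N(X) = X.
  apply/eqP; rewrite eqEsubset subsetI sXN -/(abelian X) cycle_abelian andbT.
  by rewrite /X cent_cycle (subset_trans (setSI _ (subsetIl _ _))) ?cent1_cycle.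
have isoN : N / X \isog conj_aut (cycle_group x) @* N.
  have:= first_isog_loc (conj_aut_morphism (cycle_group x)) nXN.
  by rewrite ker_conj_aut cX.
have cycA : cyclic (Aut X) by rewrite Aut_prime_cyclic.
have sAA := Aut_conj_aut (cycle_group x) N.
have cycN : cyclic (N / X) by rewrite (isog_cyclic isoN) (cyclicS sAA).
have oN : #|N / X| = e by rewrite card_quotient.
have e_lt : (e < #[x])%N.
  rewrite -oN (card_isog isoN).
  apply: leq_ltn_trans (subset_leq_card sAA) _.
  by rewrite card_Aut_cyclic ?cycle_cyclic // totient_prime // prednK ?order_gt0.
have [xk defN] := cyclicP cycN.
have /morphimP[k nXk Nk def_xk] : xk \in N / X by rewrite defN cycle_id.
have [k1|ntk] := eqVneq k 1.
  by left; rewrite -oN defN def_xk k1 morph1 cycle1 cards1.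
have Gk : k \in G^# by rewrite in_setD1 ntk; case/setIP: Nk.
have k_pr := prime_order_selfcent Gk.
have dv : (e %| #[k])%N by rewrite -oN defN -orderE def_xk morph_order.
case/primeP: (k_pr) => _ /(_ _ dv) /orP[/eqP|/eqP] ek; [by left | right].
rewrite ek in e_lt *; split => //.
by rewrite mem_primes k_pr cardG_gt0 order_dvdG //; case/setIP: Nk.
Qed.

(** Here [C] consists of the non-trivial elements of the conjugates of one
    subgroup of order [p], [k] is the number of these conjugates and [e] the
    index of the subgroup in its normalizer. *)
Lemma conjugates_of_order_selfcent p : p \in \pi(G) ->
  exists (C : {set gT}) (k e : nat),
    [/\ C \subset G^#, {in C, forall x, #[x] = p},
        #|C| = (k * p.-1)%N, #|G| = (k * (p * e))%N
      & e = 1%N \/ e \in \pi(G) /\ e < p]%N.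
Proof.
rewrite mem_primes => /and3P[p_pr _ pG].
have [x Gxx ox] := Cauchy p_pr pG.
have Gx : x \in G^# by rewrite in_setD1 -order_gt1 ox prime_gt1.
have sXG : <[x]> \subset G by rewrite cycle_subG.
have tiX := normedTI_cycle_selfcent Gx.
exists (class_support <[x]>^# G), #|G : 'N_G(<[x]>)|, #|'N_G(<[x]>) : <[x]>|.
split.
- apply/subsetP=> _ /imset2P[u g /setD1P[ntu xu] Gg ->].
  by rewrite in_setD1 conjg_eq1 ntu groupJ // (subsetP sXG).
- move=> _ /imset2P[u g /setD1P[ntu xu] _ ->]; rewrite orderJ -ox.
  by rewrite orderE (cycle_eq_selfcent Gx) // in_setD1 ntu (subsetP sXG).
- by rewrite (card_support_normedTI tiX) -ox [#[x]](cardsD1 1) group1 mulnC.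
- rewrite -ox mulnC Lagrange ?subsetI ?normG ?sXG //.
  by rewrite Lagrange ?subsetIl.
by have [-> | [_ piGe lt]] := index_norm_selfcent Gx; [left | right; rewrite -ox].
Qed.

(** The three smallest primes dividing [#|G|] would give three disjoint sets of
    non-trivial elements with more than [#|G| - 1] elements in all. Taking the
    smallest ones is what confines the normalizer indices: each is 1 or a prime
    divisor of [#|G|] below the prime it belongs to. *)
Lemma size_primes_selfcent : (size (primes #|G|) <= 2)%N.
Proof.
rewrite leqNgt; apply/negP.
move: (sorted_primes #|G|) (erefl (primes #|G|)).
case: {1 3 4}(primes #|G|) => [|p [|q [|r s]]] // sorted_pi def_pi _.
have piG t : (t \in \pi(G)) = (t \in [:: p, q, r & s]) by rewrite -def_pi.
move: sorted_pi; rewrite /= => /andP[ltpq /andP[ltqr path_r]].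
have gt_r t : t \in s -> (r < t)%N.
  by move: t; apply/allP; apply: order_path_min path_r; apply: ltn_trans.
have [|C1 [k1 [e1 [C1G o1 c1 n1 e1P]]]] := conjugates_of_order_selfcent (p := p).
  by rewrite piG inE eqxx.
have [|C2 [k2 [e2 [C2G o2 c2 n2 e2P]]]] := conjugates_of_order_selfcent (p := q).
  by rewrite piG !inE eqxx orbT.
have [|C3 [k3 [e3 [C3G o3 c3 n3 e3P]]]] := conjugates_of_order_selfcent (p := r).
  by rewrite piG !inE eqxx !orbT.
have e1E : e1 = 1%N.
  case: e1P => // -[]; rewrite piG !inE => /or4P[/eqP->|/eqP->|/eqP->|/gt_r]; lia.
have e2E : e2 = 1%N \/ e2 = p.
  case: e2P => [|[]]; [by left | rewrite piG !inE].
  case/or4P=> [/eqP->|/eqP->|/eqP->|/gt_r]; first (by right); lia.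
have e3E : (e3 <= q)%N.
  case: e3P => [->|[]]; [lia | rewrite piG !inE].
  case/or4P=> [/eqP->|/eqP->|/eqP->|/gt_r]; lia.
have p_gt1 : (1 < p)%N.
  have: p \in \pi(G) by rewrite piG inE eqxx.
  by rewrite mem_primes => /andP[/prime_gt1].
have disj a b (A B : {set gT}) : {in A, forall x, #[x] = a} ->
    {in B, forall x, #[x] = b} -> (a < b)%N -> [disjoint A & B].
  move=> oA oB ltab; apply/pred0P=> x /=; apply/negP=> /andP[/oA xa /oB].
  by rewrite xa => ab; rewrite ab ltnn in ltab.
have : (#|C1 :|: C2 :|: C3| < #|G|)%N.
  by rewrite (cardsD1 1 G) group1 ltnS subset_leq_card // !subUset C1G C2G.
have [d12 d13 d23] : [/\ [disjoint C1 & C2], [disjoint C1 & C3] & [disjoint C2 & C3]].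
  by split; [apply: disj o1 o2 _ | apply: disj o1 o3 _ | apply: disj o2 o3 _]; lia.
rewrite !cardsU setIUl !disjoint_setI0 // setU0 cards0 !subn0 c1 c2 c3.
rewrite ltnNge => /negP[].
rewrite e1E muln1 in n1.
by apply: (class_sizes_overflow _ _ n1 n2 n3); rewrite ?ltpq ?p_gt1 ?cardG_gt0.
Qed.

(** Square-freeness of [#|G|], in the form that separates the successive indices
    of a chain of subgroups. *)
Lemma coprime_selfcent a b : (a * b %| #|G|)%N -> coprime a b.
Proof.
move=> dv_ab; have := dvdn_gt0 (cardG_gt0 G) dv_ab.
rewrite muln_gt0 => /andP[a_gt0 b_gt0]; rewrite coprime_has_primes //.
apply/hasPn=> p pb; apply/negP=> /= pa.
have piGp : p \in \pi(G).
  by apply: pi_of_dvd (dvdn_trans (dvdn_mulr b (dvdnn a)) dv_ab) _ _ _.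
have := dvdn_leq_log p (cardG_gt0 G) dv_ab.
rewrite logn_selfcent // lognM // leqNgt => /negP[].
by rewrite (@leq_add 1 1) ?logn_gt0.
Qed.

(** The three indices along such a chain would be pairwise coprime and greater
    than 1, so they would provide three prime divisors of [#|G|]. *)
Lemma no_chain_selfcent (A B : {group gT}) :
  A :!=: 1 -> A \proper B -> B \proper G -> False.
Proof.
move=> ntA /andP[sAB nBA] /andP[sBG nGB].
have A_gt1 : (1 < #|A|)%N by rewrite cardG_gt1.
have iBA_gt1 : (1 < #|B : A|)%N by rewrite indexg_gt1.
have iGB_gt1 : (1 < #|G : B|)%N by rewrite indexg_gt1.
have oG : (#|A| * #|B : A| * #|G : B|)%N = #|G| by rewrite !Lagrange.
have dvG a : (a %| #|A| * #|B : A| * #|G : B| -> a %| #|G|)%N by rewrite oG.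
have neq_pdiv a b : (1 < a)%N -> coprime a b -> pdiv a != pdiv b.
  move=> a1; apply: contraTneq => eqp; rewrite /coprime neq_ltn; apply/orP; right.
  rewrite (leq_trans (prime_gt1 (pdiv_prime a1))) // dvdn_leq //.
    by rewrite gcdn_gt0 ltnW.
  by rewrite dvdn_gcd pdiv_dvd eqp pdiv_dvd.
have size_s := size_primes_selfcent.
pose s := [:: pdiv #|A|; pdiv #|B : A|; pdiv #|G : B|].
suffices: (size s <= size (primes #|G|))%N by rewrite leqNgt ltnS size_s.
apply: uniq_leq_size => [|p].
  rewrite /= !inE negb_or !neq_pdiv // coprime_selfcent // dvG //.
  - by rewrite -mulnA dvdn_mull.
  - by rewrite mulnAC dvdn_mulr.
  by rewrite dvdn_mulr.
have pi_dv a : (1 < a)%N -> (a %| #|A| * #|B : A| * #|G : B|)%N ->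
    pdiv a \in \pi(G).
  by move=> a_gt1 /dvG dva; rewrite (pi_of_dvd dva) ?pi_pdiv.
rewrite !inE => /or3P[]/eqP->; apply: pi_dv => //.
- by rewrite -mulnA dvdn_mulr.
- by rewrite mulnAC dvdn_mull.
by rewrite dvdn_mull.
Qed.

End SelfCentralizing.

(** * Locally finite groups *)

From mathcomp Require Import boolp classical_sets functions cardinality.

Local Open Scope group_scope.

(** The closure proof is a parameter only so that canonical instances can
    retrieve it; a finite subgroup of [G] thereby becomes a [finGroupType]. *)
Definition seq_subgroup (G : groupType) (s : seq G) (s_group : group_closed [in s]) :=
  seq_sub s.

HB.instance Definition _ G s s_group := SubFinite.on (@seq_subgroup G s s_group).
HB.instance Definition _ G s s_group :=
  SubChoice_isSubGroup.Build G (mem s) (@seq_subgroup G s s_group) s_group.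

Local Open Scope classical_set_scope.

Section D0.

Variable G : groupType.

Lemma subgroup_generated_subgroup (A : set G) : subgroup (subgroup_generated A).
Proof.
split; first by rewrite in_setE => H [[]]; rewrite in_setE.
move=> x y; rewrite !in_setE => Ax Ay H HA; have [[_ divH] _] := HA.
by have := divH x y; rewrite !in_setE; apply; [exact: Ax | exact: Ay].
Qed.

(** [centralizer x] is a subgroup containing [x], so a centralizer different from
    the cyclic subgroup would make [x] deficient. *)
Lemma centralizer_D0 (x : G) : D0_group G -> x <> 1 ->
  centralizer x `<=` cyclic_subgroup x.
Proof.
move=> D0 x1; have: ~ deficient x by move=> dx; apply: (D0 (conj_class x)); exists x.
move=> ndx; apply: contra_notP ndx => nsub; split=> //.
split; last exact: nsub.
apply: smallest_sub => [|_ ->]; last exact: commute_refl.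
split; first by rewrite in_setE; exact: commute1.
move=> u v; rewrite !in_setE; rewrite /centralizer /= => cu cv.
exact: commuteM (commuteV _).
Qed.

Lemma sub_generated (A : set G) : A `<=` subgroup_generated A.
Proof. exact: sub_gen_smallest. Qed.

Lemma group_set_preim (s : seq G) (s_group : group_closed [in s]) (H : set G) :
  subgroup H ->
  group_set (finset (fun t : seq_subgroup s_group => val t \in H)).
Proof.
move=> H_group; apply/group_setP; split.
  by rewrite finset.in_set gmulf1; case: H_group.
by move=> t u; rewrite !finset.in_set gmulfM; apply: group_closedM.
Qed.

(** Commuting in the subgroup is commuting in [G], and the cyclic subgroup of
    [G] generated by [val t] is the image of [<[t]>]. *)
Lemma cent1_seq_subgroup (s : seq G) (s_group : group_closed [in s]) :
  D0_group G ->
  let T := [set: seq_subgroup s_group]%G in {in T^#, forall t, 'C_T[t] = <[t]>}%g.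
Proof.
move=> D0 T t /setD1P[nt1 _]; apply/eqP.
rewrite finset.setTI finset.eqEsubset cycle_subG cent1id andbT.
apply/fintype.subsetP=> u /cent1P ct.
pose H := [set val v | v in [set v | v \in <[t]>%g]].
have: cyclic_subgroup (val t) `<=` H.
  apply: smallest_sub => [|_ ->]; last by exists t => //=; exact: cycle_id.
  split; first by rewrite in_setE; exists 1; rewrite /= ?group1 ?gmulf1.
  move=> v w; rewrite !in_setE => -[a /= ta <-] [b /= tb <-].
  by exists (a * b^-1); rewrite /= ?groupM ?groupV ?gmulfM ?gmulfV.
move=> /(_ (val u)) []; last by move=> v /= tv /val_inj <-.
apply: (centralizer_D0 D0).
  by move/eqP: nt1 => nt1 t1; apply: nt1; apply: val_inj; rewrite t1 gmulf1.
by apply: (gmulf_commute val); apply: commute_sym.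
Qed.

End D0.

Theorem theorem3 (G : groupType) (locfinG : locally_finite G)
    (D0G : D0_group G) :
  finite_set [set: G].
Proof.
apply: contrapT => infG.
have fin_gen (A : set G) : finite_set A -> finite_set (subgroup_generated A).
  by move=> finA; apply: locfinG; exists A.
have escape (S : set G) : finite_set S -> exists w, ~ S w.
  by move=> finS; apply: contra_notP infG => /forallNP allS;
     apply: sub_finite_set finS => w _; apply: contrapT.
(* Adjoining elements one at a time gives the chain [1 < S1 < S2 < S3]. *)
have [x x1] := escape _ (finite_set1 1).
pose S1 := subgroup_generated [set x].
have [y S1y] := escape S1 (fin_gen _ (finite_set1 x)).
pose S2 := subgroup_generated [set x; y].
have fin2 : finite_set S2 by apply: fin_gen; rewrite finite_setU; split; exact: finite_set1.
have [z S2z] := escape S2 fin2.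
pose S3 := subgroup_generated [set x; y; z].
have [s S3E] : exists s : seq G, S3 = [set` s].
  by apply/finite_seqP/fin_gen; rewrite !finite_setU; do ?split; exact: finite_set1.
have s_group : group_closed [in s].
  have := subgroup_generated_subgroup [set x; y; z].
  rewrite -/S3 S3E; case=> s1 s_div; split; first by rewrite in_setE in s1.
  by move=> u v us vs; have := s_div u v; rewrite !in_setE; apply.
pose T := seq_subgroup s_group.
have lift u : [set x; y; z] u -> exists t : T, val t = u.
  move=> /sub_generated; rewrite -/S3 S3E => su; by exists (Sub u su).
have [[tx xE] [ty yE] [tz zE]] : [/\ exists t : T, val t = x,
    exists t : T, val t = y & exists t : T, val t = z].
  by split; apply: lift; [left; left | left; right | right].
pose A := Group (group_set_preim s_group (subgroup_generated_subgroup [set x])).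
pose B := Group (group_set_preim s_group (subgroup_generated_subgroup [set x; y])).
have inA t : (t \in A) = (val t \in S1) by rewrite inE.
have inB t : (t \in B) = (val t \in S2) by rewrite inE.
apply: (no_chain_selfcent (cent1_seq_subgroup (s_group := s_group) D0G)
  (A := A) (B := B)).
- apply/trivgPn; exists tx.
    by rewrite inA xE in_setE; exact: sub_generated.
  by apply/eqP=> tx1; apply: x1; rewrite -xE tx1 gmulf1.
- apply/properP; split.
    apply/fintype.subsetP=> t; rewrite inA inB !in_setE; apply: smallest_sub => [|_ ->].
      exact: subgroup_generated_subgroup.
    by apply: sub_generated; left.
  exists ty; first by rewrite inB yE in_setE; apply: sub_generated; right.
  by rewrite inA yE; apply/negP; rewrite in_setE.
- apply/properP; split; first by apply/fintype.subsetP=> t _; rewrite finset.in_setT.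
  exists tz; first by rewrite finset.in_setT.
  by rewrite inB zE; apply/negP; rewrite in_setE.
Qed.
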